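(* Let $t$ be an integer with $t \ge 14$ or $t=12$, and let $s$ be an integer. If $s \ge t$, then $\mu(C_s \Box C_t) = 3t$.
   Context: All graphs are finite, simple and undirected. For a graph $G$ and $M \subseteq V(G)$, a shortest $u,v$-path $P$ of $G$ is called $M$-unhindered if $P$ does not contain a vertex of $M \setminus \{u,v\}$. Vertices $u,v \in M$ are $M$-visible if $G$ admits an $M$-unhindered (shortest) $u,v$-path. The set $M$ is a mutual-visibility set of $G$ if its vertices are pairwise $M$-visible. The mutual-visibility number $\mu(G)$ is the size of a largest mutual-visibility set of $G$. The Cartesian product $G \Box H$ has vertex set $V(G)\times V(H)$, with $(x_1,x_2)$ and $(y_1,y_2)$ adjacent whenever $x_1y_1\in E(G)$ and $x_2=y_2$, or $x_2y_2\in E(H)$ and $x_1=y_1$. $C_t$ ($t\ge 3$) denotes the cycle on $t$ vertices $\{0,1,\ldots,t-1\}$. *)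

(* Defs.v *)
From mathcomp Require Import all_boot.

Set Implicit Arguments.
Unset Strict Implicit.
Unset Printing Implicit Defensive.

Record sgraph := SGraph {
  vertex :> finType;
  adj : rel vertex;
  adj_sym : symmetric adj;
  adj_irr : irreflexive adj
}.

(* Vertices i and j are adjacent when they differ by 1 modulo n. The guard
   [i != j] only matters for n = 1, where it rules out a loop; C_n is the usual
   cycle only for n >= 3. *)
Definition cycle_adj (n : nat) : rel 'I_n :=
  [rel i j | (i != j) && ((j == ordS i) || (i == ordS j))].

Lemma cycle_adj_sym n : symmetric (@cycle_adj n).
Proof. by move=> i j; rewrite /cycle_adj /= (eq_sym i) orbC. Qed.

Lemma cycle_adj_irr n : irreflexive (@cycle_adj n).
Proof. by move=> i; rewrite /cycle_adj /= eqxx. Qed.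

Definition cycle_graph (n : nat) : sgraph :=
  SGraph (@cycle_adj_sym n) (@cycle_adj_irr n).

Definition box_adj (G H : sgraph) : rel (G * H) :=
  [rel x y | (adj x.1 y.1 && (x.2 == y.2)) || (adj x.2 y.2 && (x.1 == y.1))].

Lemma box_adj_sym (G H : sgraph) : symmetric (@box_adj G H).
Proof.
move=> x y; rewrite /box_adj /= (adj_sym x.1) (adj_sym x.2).
by rewrite (eq_sym x.1) (eq_sym x.2).
Qed.

Lemma box_adj_irr (G H : sgraph) : irreflexive (@box_adj G H).
Proof. by move=> x; rewrite /box_adj /= !adj_irr. Qed.

Definition box_graph (G H : sgraph) : sgraph :=
  SGraph (@box_adj_sym G H) (@box_adj_irr G H).

Section MutualVisibility.
Variable G : sgraph.
Implicit Types (M : {set G}) (u v : G) (p : seq G).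

(* As in [path], the vertex sequence of the path is u :: p, and its length
   (number of edges) is [size p]. *)
Definition upath u v p : bool :=
  [&& path (@adj G) u p, last u p == v & uniq (u :: p)].

Definition shortest_path u v p : bool :=
  upath u v p &&
  [forall n : 'I_(size p), forall q : n.-tuple G, ~~ upath u v q].

Definition unhindered M u v p : bool :=
  shortest_path u v p && all [predC M :\: [set u; v]] (u :: p).

(* A path has fewer than #|G| edges, so the bound on n loses nothing; see
   [visibleP]. *)
Definition visible M u v : bool :=
  [exists n : 'I_#|G|, exists p : n.-tuple G, unhindered M u v p].

Definition mutual_visibility_set M : bool :=
  [forall u in M, forall v in M, visible M u v].

Definition mutual_visibility_number : nat :=
  \max_(M : {set G} | mutual_visibility_set M) #|M|.

Lemma shortest_pathP u v p :
  reflect (upath u v p /\ forall q, upath u v q -> size p <= size q)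
          (shortest_path u v p).
Proof.
apply: (iffP andP) => -[up min_p]; split=> //.
  move=> q uq; rewrite leqNgt; apply/negP=> lt_qp.
  move/forallP/(_ (Ordinal lt_qp))/forallP/(_ (in_tuple q)): min_p.
  by rewrite uq.
apply/forallP=> n; apply/forallP=> q; apply/negP=> /min_p.
by rewrite size_tuple leqNgt ltn_ord.
Qed.

Lemma visibleP M u v :
  reflect (exists p, unhindered M u v p) (visible M u v).
Proof.
apply: (iffP existsP) => [[n /existsP[p hp]]|[p hp]]; first by exists p.
have lt_p : size p < #|G|.
  case/andP: (hp) => /andP[/and3P[_ _ up] _] _.
  by rewrite -[_.+1]/(size (u :: p)) -(card_uniqP up) max_card.
by exists (Ordinal lt_p); apply/existsP; exists (in_tuple p).
Qed.

End MutualVisibility.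

(* Main.v *)
From Stdlib Require Import ZArith Lia.
From mathcomp Require Import all_boot zify.
Require Import Defs.

(** Upper bound. A shortest path between two vertices of the same row, a copy of
    C_s, stays in that row, because dropping its vertical steps would shorten it.
    Of four marked vertices a < b < c < d of a row, b and d separate a from c on
    the cycle, so a and c do not see each other. Each of the t rows therefore
    holds at most three marks.

    Lower bound. Everything is unrolled to the integer grid, where the wanted
    shortest paths are staircases: monotone walks through unmarked cells, at most
    half a turn long in each direction ([torus_walk_size], [stair_walk]).

    It is enough to treat s = t. Given a pattern on the t x t torus with three
    marks in each column, empty columns are inserted evenly, by sending column x
    to the integer part of s x / t. Empty columns never obstruct a staircase, and
    two columns at distance at most s / 2 come from columns at distance at most
    (t + 1) / 2, so a pattern that works for all pairs up to this distance
    ([joined]) works for every s >= t ([le_mutual_visibility]).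

    For t >= 15 other than 16, the marks lie on curves of slope 1/2, numbered by
    the integers from bottom to top, about t / 3 columns apart, three of them up
    to a shift by t columns. A column meets only the curves of one parity, and
    neighbouring columns have different parities (with one exception per turn for
    even t). So the curves are permeable where the opposite parity prevails, and a
    staircase that descends to the right, against the slope, can cross one curve
    in each column ([stair_descent]). A staircase that ascends to the right runs
    in a band between two neighbouring curves, into which its first column leads
    ([stair_ascent]); only when it ends one column further does it cross another
    curve there. The bounds on the distances leave four candidates for the curve
    of the target in the first case and five in the second one. The bands are wide
    enough when neighbouring curves are at least 5 columns apart, or 6 for even t,
    which fails for t = 12, 14 and 16; there an explicit pattern is verified by
    search ([joined_table]). *)

(** * Staircases in the integer grid *)

(** A walk from (x, y) whose steps go right or in the vertical direction d; every
    cell it enters satisfies F. Such walks are the unrolled shortest paths of the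
    torus. *)
Inductive stair (F : Z -> Z -> Prop) (d x y : Z) : Z -> Z -> Prop :=
| stair_refl : stair F d x y x y
| stair_right x1 y1 :
    stair F d x y x1 y1 -> F (x1 + 1)%Z y1 -> stair F d x y (x1 + 1) y1
| stair_vert x1 y1 :
    stair F d x y x1 y1 -> F x1 (y1 + d)%Z -> stair F d x y x1 (y1 + d).

(** The cell (x, y) may be entered on the way to (x', y'). *)
Definition sole (M : Z -> Z -> Prop) (x' y' x y : Z) : Prop :=
  M x y -> x = x' /\ y = y'.

Section Staircases.
Local Open Scope Z_scope.
Implicit Types (F M : Z -> Z -> Prop).

Lemma stair_row F d x y x1 x2 y1 : stair F d x y x1 y1 -> x1 <= x2 ->
  (forall z, x1 < z <= x2 -> F z y1) -> stair F d x y x2 y1.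
Proof.
move=> st le12 clear_row.
have all n : 0 <= n -> n <= x2 - x1 -> stair F d x y (x1 + n) y1.
  move: n; apply: (natlike_ind (fun n => n <= x2 - x1 -> stair F d x y (x1 + n) y1)).
    by rewrite Z.add_0_r.
  move=> n n_ge0 IH n_le; rewrite (_ : x1 + Z.succ n = x1 + n + 1); last by lia.
  by apply: stair_right; [apply: IH; lia | apply: clear_row; lia].
by rewrite (_ : x2 = x1 + (x2 - x1)); [apply: all; lia | lia].
Qed.

Lemma stair_column F d x y x1 y1 n : stair F d x y x1 y1 -> 0 <= n ->
  (forall m, 0 < m <= n -> F x1 (y1 + d * m)) -> stair F d x y x1 (y1 + d * n).
Proof.
move=> st n_ge0 clear_column.
have all m : 0 <= m -> m <= n -> stair F d x y x1 (y1 + d * m).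
  move: m; apply: (natlike_ind (fun m => m <= n -> stair F d x y x1 (y1 + d * m))).
    by rewrite Z.mul_0_r Z.add_0_r.
  move=> m m_ge0 IH m_le.
  rewrite (_ : y1 + d * Z.succ m = y1 + d * m + d); last by lia.
  apply: stair_vert; first by apply: IH; lia.
  by rewrite (_ : y1 + d * m + d = y1 + d * (m + 1)); [apply: clear_column; lia | lia].
by apply: all; lia.
Qed.

Lemma stair_up F x y x1 y1 y2 : stair F 1 x y x1 y1 -> y1 <= y2 ->
  (forall w, y1 < w <= y2 -> F x1 w) -> stair F 1 x y x1 y2.
Proof.
move=> st le12 clear_column; rewrite (_ : y2 = y1 + 1 * (y2 - y1)); last by lia.
by apply: stair_column st _ _ => [|m m_in]; [lia | apply: clear_column; lia].
Qed.

Lemma stair_down F x y x1 y1 y2 : stair F (-1) x y x1 y1 -> y2 <= y1 ->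
  (forall w, y2 <= w < y1 -> F x1 w) -> stair F (-1) x y x1 y2.
Proof.
move=> st le21 clear_column; rewrite (_ : y2 = y1 + -1 * (y1 - y2)); last by lia.
by apply: stair_column st _ _ => [|m m_in]; [lia | apply: clear_column; lia].
Qed.

(** A step to the right lowers 2y - x by 1 and a step up raises it by 2, so a
    band of three consecutive values of 2y - x is wide enough to climb in: at
    each cell one of the two steps stays in the band. *)
Lemma stair_band F x y lo hi x1 y1 x2 y2 :
  stair F 1 x y x1 y1 -> lo + 2 <= hi -> x1 <= x2 -> y1 <= y2 ->
  lo <= 2 * y1 - x1 <= hi -> lo <= 2 * y2 - x2 <= hi ->
  (forall z w, lo <= 2 * w - z <= hi -> F z w) ->
  stair F 1 x y x2 y2.
Proof.
move=> st wide le_x le_y in1 in2 clear_band.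
have n_ge0 : 0 <= x2 - x1 + (y2 - y1) by lia.
move En : (x2 - x1 + (y2 - y1)) n_ge0 => n n_ge0.
move: n n_ge0 x1 y1 st le_x le_y in1 En.
apply: (natlike_ind (fun n => forall x1 y1, stair F 1 x y x1 y1 -> x1 <= x2 ->
  y1 <= y2 -> lo <= 2 * y1 - x1 <= hi -> x2 - x1 + (y2 - y1) = n ->
  stair F 1 x y x2 y2)).
  move=> x1 y1 st le_x le_y _ En.
  have -> : x2 = x1 by lia.
  by have -> : y2 = y1 by lia.
move=> n n_ge0 IH x1 y1 st le_x le_y in1 En.
have [move_x|move_y] : x1 < x2 /\ lo + 1 <= 2 * y1 - x1 \/
                       y1 < y2 /\ 2 * y1 - x1 <= hi - 2 by lia.
  apply: (IH (x1 + 1) y1); try lia.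
  by apply: stair_right => //; apply: clear_band; lia.
apply: (IH x1 (y1 + 1)); try lia.
by apply: stair_vert => //; apply: clear_band; lia.
Qed.

Lemma stair_translate M d a b x' y' x y x1 y1 :
  (forall z w, M (z + a) (w + b) -> M z w) ->
  stair (sole M x' y') d x y x1 y1 ->
  stair (sole M (x' + a) (y' + b)) d (x + a) (y + b) (x1 + a) (y1 + b).
Proof.
move=> shiftM; elim=> [|z w _ IH clear_z|z w _ IH clear_z]; first by constructor.
- have E : z + 1 + a = z + a + 1 by ring.
  rewrite E; apply: stair_right IH _; rewrite -E => /shiftM /clear_z[-> ->] //.
- have E : w + d + b = w + b + d by ring.
  rewrite E; apply: stair_vert IH _; rewrite -E => /shiftM /clear_z[-> ->] //.
Qed.
End Staircases.

(** * Patterns on the square torus *)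

(** Both coordinates are reduced modulo N, so only the values of f on the columns
    0, ..., N - 1 matter, and they describe a subset of the N x N torus. *)
Definition marked (N : Z) (f : Z -> nat -> Z) (x y : Z) : Prop :=
  exists2 k, k < 3 & ((y - f (x mod N) k) mod N = 0)%Z.

Definition spread (N : Z) (f : Z -> nat -> Z) : Prop := forall x, (0 <= x < N ->
  f x 0%nat < f x 1%nat /\ f x 1%nat < f x 2%nat /\ f x 2%nat < f x 0%nat + N)%Z.

(** Any two marks that are at most (N + 1) / 2 columns apart can be joined by a
    staircase through unmarked cells. Up to that distance both horizontal
    directions are required to work: after empty columns have been inserted, a
    shortest path may use either of them. In the vertical direction, which stays
    as it is, the nearest copy of the target suffices. *)
Definition joined (N : Z) (M : Z -> Z -> Prop) : Prop := forall X Y X' Y',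
  M X Y -> M X' Y' -> (X <= X' <= X + (N + 1) / 2)%Z ->
  exists d Y1, [/\ Z.abs d = 1, (Y1 - Y') mod N = 0, 2 * Z.abs (Y1 - Y) <= N,
    d * (Y1 - Y) = Z.abs (Y1 - Y) & stair (sole M X' Y1) d X Y X' Y1]%Z.

(** * Curves of slope one half *)

Section Curves.
Local Open Scope Z_scope.
Local Ltac Zify.zify_post_hook ::= Z.to_euclidean_division_equations.

Variable t : Z.
Hypotheses (t_ge : 15 <= t) (t_ne : t <> 16).

Definition window := (t + 1) / 2.

(** The largest integer not above r t / 3 with the parity of r t. *)
Definition offset r := 2 * ((r * t / 3 - r * (t mod 2)) / 2) + r * (t mod 2).
Definition shift i := t * (i / 3) + offset (i mod 3).
Definition height x i := (x + shift i) / 2.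

(** Curve i is marked in the columns whose colour has the parity of i, so each
    column meets every second curve only. Colours alternate, except that for even
    t the columns n t - 1 and n t agree for each n: as a translation by t turns
    curve i into curve i + 3, this makes the pattern t-periodic. *)
Definition colour x := x + (1 - t mod 2) * (x / t).
Definition on i x := (colour x - i) mod 2 = 0.

Definition curves x y := exists2 i, on i x & y = height x i.

Lemma shift_split i : exists q r, (r = 0 \/ r = 1 \/ r = 2) /\ i = q * 3 + r.
Proof. by exists (i / 3), (i mod 3); lia. Qed.

Lemma shiftE q r : 0 <= r < 3 -> shift (q * 3 + r) = t * q + offset r.
Proof.
move=> r_in; rewrite /shift Z.div_add_l // Z.div_small // Z.add_0_r.
by rewrite (Z.add_comm (q * 3)) Z_mod_plus_full Z.mod_small.
Qed.

Lemma shift_period i j : j = i + 3 -> shift j = shift i + t.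
Proof.
move=> ->; have [q [r [r_in ->]]] := shift_split i.
rewrite (_ : q * 3 + r + 3 = (q + 1) * 3 + r); last by ring.
by rewrite !shiftE; lia.
Qed.

Lemma shift_gap i j : j = i + 1 ->
  shift i + 5 <= shift j /\ window <= 2 * (shift j - shift i).
Proof.
rewrite /window => ->; have [q [r [[->|[->|->]] ->]]] := shift_split i.
- by rewrite -Z.add_assoc !shiftE // /offset; lia.
- by rewrite -Z.add_assoc !shiftE // /offset; lia.
- rewrite (_ : q * 3 + 2 + 1 = (q + 1) * 3 + 0); last by ring.
  by rewrite !shiftE // /offset; lia.
Qed.

(** Two consecutive gaps together exceed the window, so the ascending staircases
    from a mark reach no mark that lies two or more curves lower. *)
Lemma shift_gap2 i j : j = i + 2 -> window + 2 - t mod 2 <= shift j - shift i.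
Proof.
rewrite /window => ->; have [q [r [[->|[->|->]] ->]]] := shift_split i.
- by rewrite -Z.add_assoc !shiftE // /offset; lia.
- rewrite (_ : q * 3 + 1 + 2 = (q + 1) * 3 + 0); last by ring.
  by rewrite !shiftE // /offset; lia.
- rewrite (_ : q * 3 + 2 + 2 = (q + 1) * 3 + 1); last by ring.
  by rewrite !shiftE // /offset; lia.
Qed.

Lemma shift_incr i j : i <= j -> shift i + 5 * (j - i) <= shift j.
Proof.
move=> le_ij; have all n : 0 <= n -> shift i + 5 * n <= shift (i + n).
  move: n; apply: (natlike_ind (fun n => shift i + 5 * n <= shift (i + n))).
    by rewrite Z.add_0_r; lia.
  move=> n n_ge0 IH; rewrite Z.add_succ_r.
  by have [] := shift_gap (i + n) (Z.succ (i + n)) ltac:(lia); lia.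
by have := all (j - i) ltac:(lia); rewrite Zplus_minus; lia.
Qed.

Lemma parity :
  t mod 2 = 1 /\ (forall x, colour x = x) /\ (forall i, (shift i - i) mod 2 = 0) \/
  t mod 2 = 0 /\ (forall i, shift i mod 2 = 0).
Proof.
have [t0|t1] : t mod 2 = 0 \/ t mod 2 = 1 by lia.
- right; split=> // i; have [q [r [r_in ->]]] := shift_split i.
  rewrite shiftE ?/offset ?t0; last by lia.
  have [h ->] : exists h, t = 2 * h by exists (t / 2); lia.
  rewrite -Z.mul_assoc; move: (h * q) => hq.
  case: r_in => [->|[->|->]]; lia.
- left; split=> //; split=> [x|i]; first by rewrite /colour t1; lia.
  have [q [r [r_in ->]]] := shift_split i.
  rewrite shiftE ?/offset ?t1; last by lia.
  have [h ->] : exists h, t = 2 * h + 1 by exists (t / 2); lia.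
  rewrite Z.mul_add_distr_r -Z.mul_assoc; move: (h * q) => hq.
  case: r_in => [->|[->|->]]; lia.
Qed.

Lemma colour_step x x' : x' = x + 1 -> colour x' = colour x + 1 \/
  colour x' = colour x + 2 /\ x' mod 2 = 0 /\ forall i, shift i mod 2 = 0.
Proof.
move=> ->; rewrite /colour; case: parity => [[-> _]|[t0 even]]; first by left; lia.
rewrite t0.
have [E|[E E']] : (x + 1) / t = x / t \/ (x + 1) / t = x / t + 1 /\ x + 1 = t * (x / t + 1).
  have := Z.div_mod x t ltac:(lia); have := Z.mod_pos_bound x t ltac:(lia).
  move: (x / t) (x mod t) => q r r_in ->.
  have [lt_r|ge_r] := Z_lt_le_dec (r + 1) t; [left|right; split].
  + by rewrite -Z.add_assoc Z.mul_comm Z.div_add_l ?Z.div_small; lia.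
  + rewrite (_ : t * q + r + 1 = (q + 1) * t); last by nia.
    by rewrite Z.div_mul; lia.
  + nia.
- by left; rewrite E; lia.
- right; rewrite E; split; first by lia.
  by split=> //; rewrite E' Z.mul_mod // t0 Z.mul_0_l.
Qed.

(** The window is shorter than t, so it contains at most one pair of neighbouring
    columns of the same colour. *)
Lemma colour_window x z : x <= z <= x + window ->
  z - x <= colour z - colour x <= z - x + 1.
Proof.
rewrite /window /colour => z_in.
have le1 : x / t <= z / t by apply: Z.div_le_mono; lia.
have le2 : z / t <= x / t + 1.
  by rewrite -Z.div_add; [apply: Z.div_le_mono; lia | lia].
by have [->|->] : t mod 2 = 0 \/ t mod 2 = 1; lia.
Qed.

(** A curve has marks in neighbouring columns only where the colours do not
    alternate, and there its height steps up. *)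
Lemma height_strict i x x' : on i x -> on i x' -> x < x' -> height x i < height x' i.
Proof.
rewrite /on /height => on_x on_x' lt_x.
have [Ex|ne] := Z.eq_dec x' (x + 1); last by lia.
by case: (colour_step x x' Ex) => [|[E [? /(_ i)]]]; lia.
Qed.

(** Since the curves are ordered, a cell between curves a and b can only be a mark
    of the finitely many curves in between. *)
Lemma off_curves a b z w : height z a < w < height z b ->
  (forall j, a < j < b -> on j z -> height z j <> w) -> ~ curves z w.
Proof.
move=> w_in off [j on_j Ew]; rewrite Ew in w_in; rewrite /height in w_in.
have [le_ja|lt_aj] := Z_le_gt_dec j a; first by have := shift_incr j a; lia.
have [le_bj|lt_jb] := Z_le_gt_dec b j; first by have := shift_incr b j; lia.
by apply: (off j) => //; lia.
Qed.

Lemma off_band l l' z w : l' = l + 1 ->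
  shift l + 1 <= 2 * w - z <= shift l' - 2 -> ~ curves z w.
Proof. by move=> El w_in; apply: (off_curves l l') => [|j]; rewrite /height; lia. Qed.

(** ** Ascending staircases *)

Section Ascent.
Variables (i k X X' : Z).
Hypotheses (on_u : on i X) (on_v : on k X') (X_in : X <= X' <= X + window).
Let Y := height X i.
Let Y' := height X' k.
Hypotheses (le_Y : Y <= Y') (near_Y : 2 * (Y' - Y) <= t) (ahead : i = k -> X < X').
Let F := sole curves X' Y'.

(* F always admits its target, so a staircase may end by a step up into it. *)
Let ascend_last x y : stair F 1 X Y x y -> x = X' -> y + 1 = Y' -> stair F 1 X Y X' Y'.
Proof.
by move=> st Ex Ey; have := stair_vert _ _ _ _ _ _ st; rewrite Ey Ex; apply=> _.
Qed.

Let band_free l l' : l' = l + 1 ->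
  forall z w, shift l + 1 <= 2 * w - z <= shift l' - 2 -> F z w.
Proof. by move=> El z w w_in /(off_band _ _ _ _ El w_in). Qed.

(* After one or two columns, the row of a mark enters the band below its curve. *)
Let ascend_right : stair F 1 X Y (2 * Y - shift i + 2) Y.
Proof.
apply: (stair_row _ _ _ _ X); [by constructor | rewrite /Y /height; lia |].
move=> z z_in; case/(off_curves (i - 1) (i + 1)).
  have := shift_incr (i - 1) i; have := shift_incr i (i + 1).
  by move: z_in; rewrite /Y /height; lia.
move=> j j_in; have -> : j = i by lia.
by move=> /(height_strict i X z on_u); rewrite /Y; lia.
Qed.

(* Column X is free between curves i and i + 2. *)
Let ascend_up y : Y <= y < height X (i + 2) -> stair F 1 X Y X y.
Proof.
move=> y_in; apply: (stair_up _ _ _ _ Y); [by constructor | lia |].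
move=> w w_in; case/(off_curves i (i + 2)); first by move: w_in; rewrite /Y; lia.
move=> j j_in; have -> : j = i + 1 by lia.
by have := on_u; rewrite /on; lia.
Qed.

(** As the rise is at most t / 2 and v is in the window of X, it lies on one of the
    curves i - 1, ..., i + 3. The first two are reached below curve i, the third above it; otherwise curve
    i + 1 is passed in the column of u, and curve i + 3 comes into reach only in
    the next column, where curve i + 2 can be passed as well. *)
Lemma stair_ascent : stair F 1 X Y X' Y'.
Proof.
have g1 := shift_incr (i - 1) i ltac:(lia). have g2 := shift_incr i (i + 1) ltac:(lia).
have g3 := shift_incr (i + 1) (i + 2) ltac:(lia).
have g4 := shift_incr (i + 2) (i + 3) ltac:(lia).
have per := shift_period i (i + 3) ltac:(lia).
have [k_le|[Ek|[Ek|[Ek|[Ek|[Ek|k_ge]]]]]] : k <= i - 2 \/ k = i - 1 \/ k = i \/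
  k = i + 1 \/ k = i + 2 \/ k = i + 3 \/ i + 4 <= k by lia.
- exfalso; have gap := shift_incr k (i - 2) k_le.
  have gap2 := shift_gap2 (i - 2) i ltac:(lia).
  case: parity => [[odd_t [colourE shift_odd]]|[even_t shift_even]].
    have := colourE X; have := colourE X'; have := shift_odd i; have := shift_odd k.
    by have := on_u; have := on_v; have := le_Y; rewrite /on /Y /Y' /height; lia.
  by have := shift_even i; have := le_Y; rewrite /Y /Y' /height; lia.
- have Es : shift k = shift (i - 1) by rewrite Ek.
  apply: (stair_row _ _ _ _ (2 * Y' - shift k - 1)); last 1 first.
  + move=> z z_in on_line; have [//|ne_z] := Z.eq_dec z X'.
    case/(off_curves (i - 2) i): on_line.
      by move: z_in; have := shift_incr (i - 2) k; rewrite /Y' /height; lia.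
    move=> j j_in; have -> : j = k by lia.
    by move=> on_z; move: z_in; have := height_strict k z X' on_z on_v; rewrite /Y'; lia.
  + apply: stair_band ascend_right _ _ _ _ _ (band_free k i _);
      have := le_Y; rewrite /Y /Y' /height; lia.
  + by rewrite /Y' /height; lia.
- have Es : shift k = shift i by rewrite Ek.
  have on_v' : on i X' by rewrite -Ek.
  have := height_strict i X X' on_u on_v' ltac:(lia); rewrite /height => rise.
  apply: (ascend_last X' (Y' - 1)) => //; try lia.
  apply: stair_band ascend_right _ _ _ _ _ (band_free (i - 1) i _);
    rewrite /Y /Y' /height; lia.
- have Es : shift k = shift (i + 1) by rewrite Ek.
  apply: (ascend_last X' (Y' - 1)) => //; try lia.
  apply: stair_band (ascend_up (Y + 1) _) _ _ _ _ _ (band_free i k _);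
    rewrite /Y /Y' /height; lia.
- have Es : shift k = shift (i + 2) by rewrite Ek.
  apply: (ascend_last X' (Y' - 1)) => //; try lia.
  apply: stair_band (ascend_up ((X + shift (i + 1) + 2) / 2) _) _ _ _ _ _ (band_free (i + 1) k _);
    rewrite /Y /Y' /height; lia.
- have EX' : X' = X + 1.
    case: parity => [[odd_t [colourE shift_odd]]|[even_t shift_even]].
      have := colourE X; have := colourE X'; have := shift_odd i; have := shift_odd k.
      by have := on_u; have := on_v; have := near_Y; rewrite /on /Y /Y' Ek /height; lia.
    have := shift_even i; have [EX|] := Z.eq_dec X X'.
      by have := on_u; have := on_v; rewrite /on EX; lia.
    by have := near_Y; rewrite /Y /Y' Ek /height; lia.
  apply: (ascend_last X' (Y' - 1)) => //; try lia.
  apply: (stair_up _ _ _ _ ((X + shift (i + 1) + 3) / 2)).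
  + rewrite EX'; apply: stair_right; first by apply: ascend_up; rewrite /Y /height; lia.
    rewrite -EX'; case/(off_curves (i + 1) (i + 3)); first by rewrite /height; lia.
    move=> j j_in; have -> : j = i + 2 by lia.
    by have := on_v; rewrite /on Ek; lia.
  + by rewrite /Y' Ek /height; lia.
  + move=> w w_in; case/(off_curves (i + 1) (i + 3)).
      by move: w_in; rewrite -Ek /Y' /height; lia.
    move=> j j_in; have -> : j = i + 2 by lia.
    by have := on_v; rewrite /on Ek; lia.
- by exfalso; have := shift_incr (i + 4) k k_ge; have := shift_incr (i + 3) (i + 4);
    have := near_Y; rewrite /Y /Y' /height; lia.
Qed.
End Ascent.

(** ** Descending staircases *)

Lemma next_on i x : exists x', [/\ x <= x' <= x + 2, on i x' &
  forall z, x <= z < x' -> ~ on i z].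
Proof.
have [on_x|off_x] := Z.eq_dec ((colour x - i) mod 2) 0.
  by exists x; split=> //; lia.
have [on_x1|off_x1] := Z.eq_dec ((colour (x + 1) - i) mod 2) 0.
  exists (x + 1); split=> //; first by lia.
  by move=> z z_in; have -> : z = x by lia.
exists (x + 2); split; first by lia.
  by have := colour_step x (x + 1); have := colour_step (x + 1) (x + 2); rewrite /on; lia.
by move=> z z_in; have [->|->] : z = x \/ z = x + 1 by lia.
Qed.

Lemma on_after i x : on i x -> exists x',
  [/\ x < x' <= x + 2, on (i - 1) x' & x' = x + 2 -> colour (x + 1) = colour x + 2].
Proof.
rewrite /on => on_x; case: (colour_step x (x + 1) ltac:(lia)) => [s1|[s1 [even1 _]]].
  by exists (x + 1); split; lia.
by exists (x + 2); split; case: (colour_step (x + 1) (x + 2) ltac:(lia)) => [s2|[s2 [even2 _]]]; lia.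
Qed.

Lemma on_before i x : on i x -> exists x',
  [/\ x - 2 <= x' < x, on (i + 1) x' & x' = x - 2 -> colour x = colour (x - 1) + 2].
Proof.
rewrite /on => on_x; case: (colour_step (x - 1) x ltac:(lia)) => [s1|[s1 [even1 _]]].
  by exists (x - 1); split; lia.
by exists (x - 2); split; case: (colour_step (x - 2) (x - 1) ltac:(lia)) => [s2|[s2 [even2 _]]]; lia.
Qed.


(** The next three lemmas find the columns in which a descending staircase crosses
    the curves between u, on curve i in column X, and v, two to four curves lower
    in column X'. Each curve is crossed in a column of the opposite colour. The
    first of these columns must be reached along the row of u, hence before curve
    i - 1 rises to that row; the last one must be so far right that the lowest
    curve to be crossed is not yet below v. The crossings start in column X if
    this is far enough, and otherwise end in the first admissible column. *)
Lemma crossing2 i X X' : on i X -> on (i - 2) X' -> X <= X' <= X + window ->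
  height X' (i - 2) < height X i -> exists x1,
  [/\ X <= x1 <= X', on i x1, (x1 - 1 + shift (i - 1)) / 2 < height X i &
      height X' (i - 2) <= (x1 + shift (i - 1) - 1) / 2].
Proof.
move=> on_u on_v X_in lt_Y.
have g1 := shift_incr (i - 2) (i - 1) ltac:(lia).
have g2 := shift_incr (i - 1) i ltac:(lia).
have gap2 := shift_gap2 (i - 2) i ltac:(lia).
have [near|far] := Z_le_gt_dec (height X' (i - 2)) ((X + shift (i - 1) - 1) / 2).
  by exists X; split=> //; move: lt_Y near; rewrite /height; lia.
move Ep : (2 * height X' (i - 2) - shift (i - 1) + 1) => p.
have p_in : X < p <= X' - 3 by move: far Ep; rewrite /height; lia.
have [x1 [x1_in on_x1 min_x1]] := next_on i p.
exists x1; split=> //; last 2 first.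
- case: parity => [[odd_t [colourE shift_odd]]|[even_t shift_even]].
    have := colourE X; have := colourE X'; have := colourE x1; have := colourE p.
    have := shift_odd i; have := shift_odd (i - 1); have := shift_odd (i - 2).
    move: (min_x1 p) on_u on_v on_x1 lt_Y Ep; rewrite /on /height; lia.
  have W1 := colour_window X p ltac:(lia); have W2 := colour_window X X' X_in.
  have W3 := colour_window X x1 ltac:(lia); have W4 := colour_window x1 X' ltac:(lia).
  have W5 := colour_window p x1 ltac:(lia).
  have := shift_even i; have := shift_even (i - 1); have := shift_even (i - 2).
  move: (min_x1 p) (min_x1 (p + 1)) on_u on_v on_x1 lt_Y Ep; rewrite /on /height.
  have [Ex|[Ex|Ex]] : x1 = p \/ x1 = p + 1 \/ x1 = p + 2 by lia.
  + by rewrite Ex; lia.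
  + by rewrite Ex; lia.
  + by case: (colour_step p (p + 1) ltac:(lia)) => [s|[s _]]; rewrite Ex in W3 W4 W5 *; lia.
- by move: Ep; rewrite /height; lia.
- by lia.
Qed.

Lemma crossing3 i X X' : on i X -> on (i - 3) X' -> X <= X' <= X + window ->
  height X' (i - 3) < height X i -> exists x1 x2,
  [/\ X <= x1 /\ x1 < x2 <= x1 + 2 /\ x2 <= X', on i x1, on (i - 1) x2,
      (x1 - 1 + shift (i - 1)) / 2 < height X i &
      height X' (i - 3) <= (x2 + shift (i - 2) - 1) / 2].
Proof.
move=> on_u on_v X_in lt_Y.
have g1 := shift_incr (i - 3) (i - 2) ltac:(lia).
have g2 := shift_incr (i - 2) (i - 1) ltac:(lia).
have g3 := shift_incr (i - 1) i ltac:(lia).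
have per := shift_period (i - 3) i ltac:(lia).
have per' := shift_period (i - 2) (i + 1) ltac:(lia).
have gap2 := shift_gap2 (i - 1) (i + 1) ltac:(lia).
move Ep : (2 * height X' (i - 3) - shift (i - 2) + 1) => p.
have [near|far] := Z_le_gt_dec p (X + 1).
  have [x2 [x2_in on_x2 slow]] := on_after i X on_u.
  exists X, x2; split=> //; last 2 first.
  - by move: lt_Y; rewrite /height; lia.
  - by move: Ep; rewrite /height; lia.
  split; first by lia.
  split; first by lia.
  have [EX|neX] := Z.eq_dec X X'; first by rewrite EX /on in on_u on_v; lia.
  have [Ex2|] := Z.eq_dec x2 (X + 2); last by lia.
  have [EX|] := Z.eq_dec X' (X + 1); last by lia.
  by have := slow Ex2; rewrite EX /on in on_u on_v *; lia.
have p_in : p <= X' - 3 by move: Ep; rewrite /height; lia.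
have [x2 [x2_in on_x2 min_x2]] := next_on (i - 1) p.
have [x1 [x1_in on_x1 slow]] := on_before (i - 1) x2 on_x2; rewrite Z.sub_add in on_x1.
exists x1, x2; split=> //; last 2 first.
- case: parity => [[odd_t [colourE shift_odd]]|[even_t shift_even]].
    have := colourE X; have := colourE X'; have := colourE x2; have := colourE p.
    have := shift_odd i; have := shift_odd (i - 2); have := shift_odd (i - 3).
    by move: (min_x2 p) on_u on_v on_x2 lt_Y Ep; rewrite /on /height; lia.
  have := shift_even i; have := shift_even (i - 1); have := shift_even (i - 2).
  by move: lt_Y Ep; rewrite /height; lia.
- by move: Ep; rewrite /height; lia.
- by lia.
Qed.

Lemma crossing4 i X X' : on i X -> on (i - 4) X' -> X <= X' <= X + window ->
  height X' (i - 4) < height X i -> 2 * (height X i - height X' (i - 4)) <= t ->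
  exists x1 x2 x3,
  [/\ X <= x1 /\ x1 < x2 <= x1 + 2 /\ x2 < x3 <= x2 + 2 /\ x3 <= X',
      [/\ on i x1, on (i - 1) x2 & on (i - 2) x3],
      (x1 - 1 + shift (i - 1)) / 2 < height X i &
      height X' (i - 4) <= (x3 + shift (i - 3) - 1) / 2].
Proof.
move=> on_u on_v X_in lt_Y near_Y.
have g1 := shift_incr (i - 4) (i - 3) ltac:(lia).
have g2 := shift_incr (i - 3) (i - 2) ltac:(lia).
have g3 := shift_incr (i - 2) (i - 1) ltac:(lia).
have [g4 gap] := shift_gap (i - 1) i ltac:(lia).
have per := shift_period (i - 3) i ltac:(lia).
have per' := shift_period (i - 4) (i - 1) ltac:(lia).
move Ep : (2 * height X' (i - 4) - shift (i - 3) + 1) => p.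
(* A drop by at most t / 2 reaches curve i - 4 only after a run to the right. *)
have far_X : X + 4 <= X' by move: near_Y; rewrite /height; lia.
have [near|far] := Z_le_gt_dec p (X + 2).
  have [x2 [x2_in on_x2 _]] := on_after i X on_u.
  have [x3 [x3_in on_x3 _]] := on_after (i - 1) x2 on_x2.
  rewrite -Z.sub_add_distr in on_x3.
  exists X, x2, x3; split=> //; first by lia.
    by move: lt_Y; rewrite /height; lia.
  by move: Ep; rewrite /height; lia.
have p_in : p <= X' - 3 by move: Ep; rewrite /height; lia.
have [x3 [x3_in on_x3 min_x3]] := next_on (i - 2) p.
have [x2 [x2_in on_x2 slow2]] := on_before (i - 2) x3 on_x3.
rewrite (_ : i - 2 + 1 = i - 1) in on_x2; last by lia.
have [x1 [x1_in on_x1 slow1]] := on_before (i - 1) x2 on_x2; rewrite Z.sub_add in on_x1.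
have le_X : X <= x1.
  have [//|gt_X] := Z_le_gt_dec X x1; exfalso.
  have Ex2 : x2 = X + 1 by lia.
  rewrite Ex2 Z.add_simpl_r in slow1 on_x2.
  by rewrite /on in on_u on_x2; lia.
exists x1, x2, x3; split=> //; first by lia.
  case: parity => [[odd_t [colourE shift_odd]]|[even_t shift_even]].
    have := colourE X; have := colourE X'; have := colourE p.
    have := colourE x1; have := colourE x2; have := colourE x3.
    have := shift_odd i; have := shift_odd (i - 1); have := shift_odd (i - 3).
    have := shift_odd (i - 4).
    by move: (min_x3 p) on_u on_v on_x1 on_x2 on_x3 lt_Y Ep; rewrite /on /height; lia.
  have := shift_even i; have := shift_even (i - 1).
  have := shift_even (i - 2); have := shift_even (i - 3).
  have W1 := colour_window X p ltac:(lia); have W2 := colour_window X X' X_in.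
  have W3 := colour_window X x3 ltac:(lia); have W4 := colour_window x3 X' ltac:(lia).
  have W5 := colour_window p x3 ltac:(lia).
  move: (min_x3 p) (min_x3 (p + 1)) on_u on_v on_x1 on_x2 on_x3 lt_Y Ep; rewrite /on /height.
  have [Ex|[Ex|Ex]] : x3 = p \/ x3 = p + 1 \/ x3 = p + 2 by lia.
  - by rewrite Ex in W3 W4 W5 x2_in slow2 *; lia.
  - by rewrite Ex in W3 W4 W5 x2_in slow2 *; lia.
  - case: (colour_step p (p + 1) ltac:(lia)) => [s|[s _]];
      rewrite Ex in W3 W4 W5 x2_in slow2 *; lia.
by move: Ep; rewrite /height; lia.
Qed.

Section Descent.
Variables (i k X X' : Z).
Hypotheses (on_u : on i X) (on_v : on k X') (X_in : X <= X' <= X + window).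
Let Y := height X i.
Let Y' := height X' k.
Hypotheses (lt_Y : Y' < Y) (near_Y : 2 * (Y - Y') <= t).
Let F := sole curves X' Y'.

(* From a cell below curve k + 1, nothing but v obstructs the way right to
   column X' and then down, as the marks of curve k left of v are lower than v. *)
Let descend_last x y : stair F (-1) X Y x y -> x <= X' -> Y' <= y ->
  y < height x (k + 2) -> (forall z, x < z -> on (k + 1) z -> y < height z (k + 1)) ->
  stair F (-1) X Y X' Y'.
Proof.
move=> st le_x le_y below2 below1.
have on_k := on_v.
have free z w : x <= z <= X' -> Y' <= w <= y -> z = X' \/ x < z /\ w = y -> F z w.
  move=> z_in w_in z_or [j on_j Ew].
  have [gt_jk|le_jk] := Z_lt_le_dec (k + 1) j.
    exfalso; have := shift_incr (k + 2) j ltac:(lia).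
    by move: below2; rewrite Ew /height in w_in *; lia.
  have [Ej|ne_jk] := Z.eq_dec j (k + 1).
    exfalso; case: z_or => [Ez|[lt_z Ewy]].
      by rewrite Ez Ej /on in on_j on_k *; lia.
    by rewrite Ej in on_j Ew; have := below1 z lt_z on_j; lia.
  have le_jk' := shift_incr j k ltac:(lia).
  have [Ez|ne_z] := Z.eq_dec z X'.
    by split=> //; rewrite Ez /Y' /height in w_in Ew *; lia.
  exfalso; have [Ej|ne_j] := Z.eq_dec j k.
    rewrite Ej in on_j Ew; have := height_strict k z X' on_j on_k ltac:(lia).
    by rewrite -Ew -/Y'; lia.
  by rewrite /Y' /height in w_in Ew; lia.
apply: (stair_down _ _ _ _ y) => //; last by move=> w w_in; apply: free; lia.
apply: (stair_row _ _ _ _ x) => // z z_in; apply: free; lia.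
Qed.

(* In column x1 curve i - 1 has no mark, so only its height one column earlier
   matters. *)
Let descend_row x1 : X <= x1 -> on i x1 -> (x1 - 1 + shift (i - 1)) / 2 < Y ->
  stair F (-1) X Y x1 Y.
Proof.
move=> le_x on_x1 low; apply: (stair_row _ _ _ _ X) => //; first by constructor.
have g1 := shift_incr (i - 2) (i - 1) ltac:(lia); have g2 := shift_incr i (i + 1) ltac:(lia).
move=> z z_in; case/(off_curves (i - 2) (i + 1)).
  by rewrite /Y /height in low *; lia.
move=> j j_in; have [->|->] : j = i - 1 \/ j = i by lia.
  move=> on_z; have [Ez|ne_z] := Z.eq_dec z x1; first by rewrite Ez /on in on_z on_x1; lia.
  by rewrite {1}/height; lia.
by move=> /(height_strict i X z on_u); rewrite -/Y; lia.
Qed.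

(* Curve l is crossed down to the highest cell from which the way right is below
   the curve. *)
Let descend_drop x y l : stair F (-1) X Y x y -> on (l + 1) x ->
  (x + shift l - 1) / 2 <= y <= height x (l + 1) ->
  stair F (-1) X Y x ((x + shift l - 1) / 2).
Proof.
move=> st on_x y_in; apply: (stair_down _ _ _ _ y) => //; first by lia.
have g := shift_incr (l - 1) l ltac:(lia).
move=> w w_in; case/(off_curves (l - 1) (l + 1)); first by rewrite /height in y_in *; lia.
by move=> j j_in; have -> : j = l by [lia]; rewrite /on in on_x *; lia.
Qed.

Let descend_slide x x2 l : stair F (-1) X Y x ((x + shift l - 1) / 2) ->
  x < x2 <= x + 2 -> stair F (-1) X Y x2 ((x + shift l - 1) / 2).
Proof.
move=> st x2_in; apply: (stair_row _ _ _ _ x) => //; first by lia.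
have g1 := shift_incr (l - 2) (l - 1) ltac:(lia); have g2 := shift_incr (l - 1) l ltac:(lia).
have g3 := shift_incr l (l + 1) ltac:(lia).
move=> z z_in; case/(off_curves (l - 2) (l + 1)); first by rewrite /height; lia.
by move=> j j_in; have [->|->] : j = l - 1 \/ j = l; rewrite /height; lia.
Qed.

(** As the drop is at most t / 2 and v is in the window of X, it lies on one of the
    curves i - 1, ..., i - 4, and there are at most three curves to cross. *)
Lemma stair_descent : stair F (-1) X Y X' Y'.
Proof.
have g0 := shift_incr i (i + 1) ltac:(lia).
have g1 := shift_incr (i - 1) i ltac:(lia).
have g2 := shift_incr (i - 2) (i - 1) ltac:(lia).
have g3 := shift_incr (i - 3) (i - 2) ltac:(lia).
have g4 := shift_incr (i - 4) (i - 3) ltac:(lia).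
have lt_uv := lt_Y; have near_uv := near_Y.
have [k_ge|[Ek|[Ek|[Ek|[Ek|k_le]]]]] :
  i <= k \/ k = i - 1 \/ k = i - 2 \/ k = i - 3 \/ k = i - 4 \/ k <= i - 5 by lia.
- by exfalso; have := shift_incr i k k_ge; rewrite /Y /Y' /height in lt_uv; lia.
- apply: (descend_last X Y); [by constructor | lia | lia | |]; rewrite Ek.
    by rewrite (_ : i - 1 + 2 = i + 1) /Y /height; lia.
  by rewrite Z.sub_add => z lt_z on_z; apply: height_strict.
- have on_k := on_v; rewrite /Y' Ek in on_k lt_uv.
  have [x1 [x1_in on_x1 low high]] := crossing2 i X X' on_u on_k X_in lt_uv.
  have st := descend_row x1 ltac:(lia) on_x1 low.
  have {}st := descend_drop x1 Y (i - 1) st; rewrite Z.sub_add in st.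
  have {}st := st on_x1 ltac:(rewrite /Y /height in low *; lia).
  apply: descend_last st _ _ _ _; rewrite /Y' ?Ek; [lia | exact: high | |].
    by rewrite Z.sub_add /height; lia.
  by rewrite (_ : i - 2 + 1 = i - 1) => [z lt_z _|]; rewrite /height; lia.
- have on_k := on_v; rewrite /Y' Ek in on_k lt_uv.
  have [x1 [x2 [x_in on_x1 on_x2 low high]]] := crossing3 i X X' on_u on_k X_in lt_uv.
  have st := descend_row x1 ltac:(lia) on_x1 low.
  have {}st := descend_drop x1 Y (i - 1) st; rewrite Z.sub_add in st.
  have {}st := st on_x1 ltac:(rewrite /Y /height in low *; lia).
  have {}st := descend_slide x1 x2 (i - 1) st ltac:(lia).
  have {}st := descend_drop x2 _ (i - 2) st; rewrite (_ : i - 2 + 1 = i - 1) in st; last by lia.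
  have {}st := st on_x2 ltac:(rewrite /height; lia).
  apply: descend_last st _ _ _ _; rewrite /Y' ?Ek; [lia | exact: high | |].
    by rewrite (_ : i - 3 + 2 = i - 1) /height; lia.
  by rewrite (_ : i - 3 + 1 = i - 2) => [z lt_z _|]; rewrite /height; lia.
- have on_k := on_v; rewrite /Y' Ek in on_k lt_uv near_uv.
  have [x1 [x2 [x3 [x_in [on_x1 on_x2 on_x3] low high]]]] :=
    crossing4 i X X' on_u on_k X_in lt_uv near_uv.
  have st := descend_row x1 ltac:(lia) on_x1 low.
  have {}st := descend_drop x1 Y (i - 1) st; rewrite Z.sub_add in st.
  have {}st := st on_x1 ltac:(rewrite /Y /height in low *; lia).
  have {}st := descend_slide x1 x2 (i - 1) st ltac:(lia).
  have {}st := descend_drop x2 _ (i - 2) st; rewrite (_ : i - 2 + 1 = i - 1) in st; last by lia.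
  have {}st := st on_x2 ltac:(rewrite /height; lia).
  have {}st := descend_slide x2 x3 (i - 2) st ltac:(lia).
  have {}st := descend_drop x3 _ (i - 3) st; rewrite (_ : i - 3 + 1 = i - 2) in st; last by lia.
  have {}st := st on_x3 ltac:(rewrite /height; lia).
  apply: descend_last st _ _ _ _; rewrite /Y' ?Ek; [lia | exact: high | |].
    by rewrite (_ : i - 4 + 2 = i - 2) /height; lia.
  by rewrite (_ : i - 4 + 1 = i - 3) => [z lt_z _|]; rewrite /height; lia.
- exfalso; have := shift_incr k (i - 5) k_le.
  have gap2 := shift_gap2 (i - 2) i ltac:(lia).
  have per := shift_period (i - 5) (i - 2) ltac:(lia).
  rewrite /Y /Y' /height in near_uv.
  case: parity => [[odd_t _]|[even_t shift_even]]; first by lia.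
  by have := shift_even i; lia.
Qed.
End Descent.

(** ** Marking the curves *)

Definition curve_heights x (k : nat) := height x (x + 2 * Z.of_nat k).

Lemma height_translate x q i : height (x + q * t) i = height x (i + 3 * q).
Proof.
rewrite /height; congr (_ / 2); have [p [r [r_in ->]]] := shift_split i.
rewrite (_ : p * 3 + r + 3 * q = (p + q) * 3 + r); last by ring.
by rewrite !shiftE; lia.
Qed.

Lemma height_period x i q : height x (i + 6 * q) = height x i + q * t.
Proof.
rewrite /height; have [p [r [r_in ->]]] := shift_split i.
rewrite (_ : p * 3 + r + 6 * q = (p + 2 * q) * 3 + r); last by ring.
by rewrite !shiftE; lia.
Qed.

Lemma marked_curves x y : marked t curve_heights x y <-> curves x y.
Proof.
have Ex := Z.div_mod x t ltac:(lia); have bnd := Z.mod_pos_bound x t ltac:(lia).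
rewrite /marked; set r := x mod t in Ex bnd *; set q := x / t in Ex *.
have Exq : x = r + q * t by lia.
(* Moving q periods to the right turns curve i into curve i + 3 q; the colours
   are shifted by an odd amount per period, which matches. *)
have [m col] : exists m, colour x + 3 * q = r + 2 * m.
  rewrite /colour -/q Exq; have [t0|t1] : t mod 2 = 0 \/ t mod 2 = 1 by lia.
  - rewrite t0; have [h ->] : exists h, t = 2 * h by exists (t / 2); lia.
    by exists (q * h + 2 * q); ring.
  - rewrite t1; have [h ->] : exists h, t = 2 * h + 1 by exists (t / 2); lia.
    by exists (q * h + 2 * q); ring.
split=> [[k lt_k3 /Z.mod_divide E]|[i on_i ->]].
- case: E => [|p E]; first by lia.
  exists (r + 2 * Z.of_nat k + 6 * p - 3 * q); first by rewrite /on; lia.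
  rewrite {1}Exq height_translate Z.sub_add height_period.
  by rewrite /curve_heights in E; lia.
- rewrite Exq height_translate.
  have [j Ej] : exists j, i + 3 * q = r + 2 * j.
    by rewrite /on in on_i; exists ((i + 3 * q - r) / 2); lia.
  exists (Z.to_nat (j mod 3)); first by lia.
  rewrite Ej /curve_heights.
  rewrite (_ : r + 2 * j = r + 2 * Z.of_nat (Z.to_nat (j mod 3)) + 6 * (j / 3)); last by lia.
  by rewrite height_period Z.add_simpl_l; apply: Z_mod_mult.
Qed.

Lemma spread_curves : spread t curve_heights.
Proof.
move=> x _; rewrite /curve_heights.
have g1 := shift_incr x (x + 2) ltac:(lia).
have g2 := shift_incr (x + 2) (x + 4) ltac:(lia).
have g3 := shift_incr (x + 4) (x + 6 * 1) ltac:(lia).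
have := height_period x x 1; rewrite Z.mul_1_l /height => period.
rewrite (_ : x + 2 * Z.of_nat 0 = x); last by lia.
rewrite (_ : x + 2 * Z.of_nat 1 = x + 2); last by lia.
rewrite (_ : x + 2 * Z.of_nat 2 = x + 4); last by lia.
lia.
Qed.

Lemma joined_curves : joined t (marked t curve_heights).
Proof.
move=> X Y X' Y' /marked_curves[i on_i ->] /marked_curves[k on_k ->] X_in.
have [q half] : exists q, 2 * Z.abs (height X' k + q * t - height X i) <= t.
  have := Z.mod_pos_bound (height X' k - height X i) t ltac:(lia).
  have := Z.div_mod (height X' k - height X i) t ltac:(lia).
  move: (_ / t) (_ mod t) => q r Er r_in.
  by have [low|high] := Z_le_gt_dec (2 * r) t; [exists (- q) | exists (- q - 1)]; lia.
rewrite -height_period in half.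
have on_k' : on (k + 6 * q) X' by rewrite /on in on_k *; lia.
set Y1 := height X' (k + 6 * q) in half *.
have cong : (Y1 - height X' k) mod t = 0.
  by rewrite /Y1 height_period Z.add_simpl_l; apply: Z_mod_mult.
have to_marked d x1 y1 : stair (sole curves X' Y1) d X (height X i) x1 y1 ->
    stair (sole (marked t curve_heights) X' Y1) d X (height X i) x1 y1.
  elim=> [|z w _ IH clear_z|z w _ IH clear_z]; first by constructor.
  - by apply: stair_right IH _ => /marked_curves /clear_z.
  - by apply: stair_vert IH _ => /marked_curves /clear_z.
have [up|down] := Z_le_gt_dec (height X i) Y1.
- exists 1, Y1; split=> //; first by lia.
  have [[Ei EX]|ahead] : i = k + 6 * q /\ X = X' \/ (i = k + 6 * q -> X < X') by lia.
    by rewrite /Y1 -Ei -EX; constructor.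
  by apply: to_marked; apply: stair_ascent => //; rewrite -/Y1; lia.
- exists (-1), Y1; split=> //; first by lia.
  by apply: to_marked; apply: stair_descent => //; rewrite -/Y1; lia.
Qed.
End Curves.

(** * Small tori by search *)

Section Tables.
Local Open Scope Z_scope.
Variables (N : Z) (table : seq (seq Z)).
Hypothesis N_gt0 : 0 < N.

Definition column x (k : nat) := nth 0 (nth [::] table (Z.to_nat x)) k.

Definition markedb x y :=
  has (fun h => (y - h) mod N =? 0) (map (column (x mod N)) (iota 0 3)).

Lemma markedP x y : reflect (marked N column x y) (markedb x y).
Proof.
rewrite /markedb has_map; apply: (iffP hasP) => [[k]|[k lt_k3 E]].
  by rewrite mem_iota => lt_k3 /Z.eqb_spec E; exists k.
by exists k; [rewrite mem_iota | apply/Z.eqb_spec].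
Qed.

(* Conditionals instead of boolean connectives stop the search at the first
   success under call-by-value evaluation. *)
Definition free x' y' z w : bool :=
  if (if z =? x' then w =? y' else false) then true else ~~ markedb z w.

Fixpoint search n d x y x' y' : bool :=
  if n is n1.+1 then
    if (if x =? x' then y =? y' else false) then true else
    if (if x <? x' then
          if free x' y' (x + 1) y then search n1 d (x + 1) y x' y' else false
        else false) then true else
    if y =? y' then false else
    if free x' y' x (y + d) then search n1 d x (y + d) x' y' else false
  else false.

Lemma freeP x' y' z w : free x' y' z w -> sole (marked N column) x' y' z w.
Proof.
rewrite /free /sole; case: ifP => [|_ /markedP off /off //].
by case: Z.eqb_spec => // Ez /Z.eqb_spec Ew.
Qed.

Lemma search_stair n d x0 y0 x y x' y' :
  stair (sole (marked N column) x' y') d x0 y0 x y -> search n d x y x' y' ->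
  stair (sole (marked N column) x' y') d x0 y0 x' y'.
Proof.
elim: n x y => //= n IH x y st.
case: ifP => [E _|_].
  case: (Z.eqb_spec x x') E => // Ex; case: (Z.eqb_spec y y') => // Ey _.
  by rewrite -Ex -Ey in st *.
case: ifP => [E _|_].
  move: E; case: Z.ltb => //; case: ifP => // /freeP clear_xy.
  by apply: IH; apply: stair_right.
case: Z.eqb_spec => // _; case: ifP => // /freeP clear_xy.
by apply: IH; apply: stair_vert.
Qed.

(* The search bound 50 exceeds the length of every staircase in the three
   tables below. *)
Definition joinable x k dx k' : bool :=
  let y := column x k in
  let r := (column ((x + dx) mod N) k' - y) mod N in
  if (if 2 * r <=? N then search 50 1 x y (x + dx) (y + r) else false) then true
  else if N <=? 2 * r then search 50 (-1) x y (x + dx) (y + r - N) else false.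

Definition all_joinable : bool :=
  all (fun x => all (fun k => all (fun dx => all (fun k' =>
    joinable (Z.of_nat x) k (Z.of_nat dx) k') (iota 0 3))
    (iota 0 (Z.to_nat ((N + 1) / 2)).+1)) (iota 0 3)) (iota 0 (Z.to_nat N)).

Definition all_spread : bool :=
  all (fun x => let h := column (Z.of_nat x) in
    [&& h 0%N <? h 1%N, h 1%N <? h 2%N & h 2%N <? h 0%N + N]) (iota 0 (Z.to_nat N)).

Lemma spread_table : all_spread -> spread N column.
Proof.
move=> /allP ok x x_in; have /ok : Z.to_nat x \in iota 0 (Z.to_nat N).
  by rewrite mem_iota; lia.
by rewrite Z2Nat.id; [case/and3P=> /Z.ltb_spec0 ? /Z.ltb_spec0 ? /Z.ltb_spec0 ? | lia].
Qed.

Lemma joined_table : all_joinable -> joined N (marked N column).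
Proof.
move=> ok X Y X' Y' [k lt_k3 EY] [k' lt_k'3 EY'] X_in.
have EX := Z.div_mod X N ltac:(lia); have x_in := Z.mod_pos_bound X N N_gt0.
case/Z.mod_divide: EY => [|p EY]; first by lia.
case/Z.mod_divide: EY' => [|p' EY']; first by lia.
have : joinable (X mod N) k (X' - X) k'.
  have /(allP ok)/allP/(_ k) : Z.to_nat (X mod N) \in iota 0 (Z.to_nat N).
    by rewrite mem_iota; lia.
  rewrite mem_iota => /(_ lt_k3)/allP/(_ (Z.to_nat (X' - X))).
  rewrite mem_iota => /(_ ltac:(lia))/allP/(_ k').
  by rewrite mem_iota => /(_ lt_k'3); rewrite !Z2Nat.id; lia.
set x := X mod N in EX x_in EY *; set q := X / N in EX *.
have Ex' : (x + (X' - X)) mod N = X' mod N.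
  by rewrite /x Zplus_mod_idemp_l Zplus_minus.
rewrite /joinable Ex'; set r := _ mod N.
have r_in : 0 <= r < N := Z.mod_pos_bound _ _ N_gt0.
have [m Er] : exists m, column (X' mod N) k' - column x k = m * N + r.
  by exists ((column (X' mod N) k' - column x k) / N);
     have := Z.div_mod (column (X' mod N) k' - column x k) N ltac:(lia); rewrite -/r; lia.
(* The search is run in the period of the first mark and translated back. *)
have translate d y1 : stair (sole (marked N column) (x + (X' - X)) y1) d
      x (column x k) (x + (X' - X)) y1 ->
    stair (sole (marked N column) X' (y1 + p * N)) d X Y X' (y1 + p * N).
  move/(stair_translate _ _ (q * N) (p * N)).
  rewrite (_ : x + (X' - X) + q * N = X'); last by lia.
  rewrite (_ : x + q * N = X); last by lia.
  rewrite (_ : column x k + p * N = Y); last by lia.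
  apply=> z w [k1 lt_k1]; rewrite Z_mod_plus_full => E; exists k1 => //.
  by rewrite -E (_ : w + p * N - _ = w - column (z mod N) k1 + p * N) ?Z_mod_plus_full //; ring.
have cong y1 : (exists n, y1 - Y' = n * N) -> (y1 - Y') mod N = 0.
  by case=> n ->; apply: Z_mod_mult.
case: ifP => [|_].
  case: Z.leb_spec0 => // low /(search_stair _ _ _ _ _ _ _ _ (stair_refl _ _ _ _)).
  move=> /translate st _; exists 1, (column x k + r + p * N).
  by split=> //; try lia; apply: cong; exists (p - p' - m); lia.
case: Z.leb_spec0 => // high /(search_stair _ _ _ _ _ _ _ _ (stair_refl _ _ _ _)).
move=> /translate st; exists (-1), (column x k + r - N + p * N).
by split=> //; try lia; apply: cong; exists (p - p' - m - 1); lia.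
Qed.
End Tables.

(** The three sizes at which the curves are too close to each other. The first
    pattern has period 4 in both directions, the second one is invariant under
    the half-turn (x, y) -> (1 - x, 1 - y), the third one under the translation
    by (4, 4). *)
Definition table12 : seq (seq Z) := map (map Z.of_nat)
  [:: [:: 3; 7; 11]; [:: 2; 6; 10]; [:: 0; 4; 8]; [:: 1; 5; 9];
      [:: 3; 7; 11]; [:: 2; 6; 10]; [:: 0; 4; 8]; [:: 1; 5; 9];
      [:: 3; 7; 11]; [:: 2; 6; 10]; [:: 0; 4; 8]; [:: 1; 5; 9]].

Definition table14 : seq (seq Z) := map (map Z.of_nat)
  [:: [:: 4; 8; 13]; [:: 2; 7; 11]; [:: 0; 5; 12]; [:: 1; 6; 10]; [:: 4; 9; 13];
      [:: 3; 7; 11]; [:: 2; 8; 12]; [:: 0; 6; 10]; [:: 1; 5; 9]; [:: 3; 7; 13];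
      [:: 4; 8; 12]; [:: 2; 6; 11]; [:: 0; 5; 9]; [:: 1; 3; 10]].

Definition table16 : seq (seq Z) := map (map Z.of_nat)
  [:: [:: 3; 7; 13]; [:: 5; 9; 15]; [:: 0; 6; 12]; [:: 2; 8; 14];
      [:: 1; 7; 11]; [:: 3; 9; 13]; [:: 0; 4; 10]; [:: 2; 6; 12];
      [:: 5; 11; 15]; [:: 1; 7; 13]; [:: 4; 8; 14]; [:: 0; 6; 10];
      [:: 3; 9; 15]; [:: 1; 5; 11]; [:: 2; 8; 12]; [:: 4; 10; 14]].

Lemma pattern_exists (t : nat) : 14 <= t \/ t = 12 ->
  exists2 f, spread (Z.of_nat t) f & joined (Z.of_nat t) (marked (Z.of_nat t) f).
Proof.
move=> ht.
have [->|ne12] := eqVneq t 12.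
  by exists (column table12); [apply: spread_table | apply: joined_table]; vm_compute.
have [->|ne14] := eqVneq t 14.
  by exists (column table14); [apply: spread_table | apply: joined_table]; vm_compute.
have [->|ne16] := eqVneq t 16.
  by exists (column table16); [apply: spread_table | apply: joined_table]; vm_compute.
exists (curve_heights (Z.of_nat t)); first by apply: spread_curves; lia.
by apply: joined_curves; lia.
Qed.

(** * Visibility along walks *)

Section Visibility.
Variable G : sgraph.
Implicit Types (M : {set G}) (u v : G) (p q : seq G).

(** Shortcutting a walk keeps its vertices, so minimality and unobstructedness may
    be checked on walks with repetitions. *)
Lemma walk_upath u v q : path (@adj G) u q -> last u q = v ->
  exists p, [/\ upath u v p, size p <= size q & {subset p <= q}].
Proof.
move=> walk_q; case/shortenP: walk_q => p walk_p uniq_p sub_p last_p; exists p.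
split=> //; first by rewrite /upath walk_p uniq_p last_p eqxx.
by apply: uniq_leq_size => //; case/andP: uniq_p.
Qed.

Lemma visible_of_walk M u v p :
  path (@adj G) u p -> last u p = v -> (forall x, x \in p -> x \in M -> x = v) ->
  (forall q, path (@adj G) u q -> last u q = v -> size p <= size q) ->
  visible M u v.
Proof.
move=> walk_p last_p clear_p min_p.
have [q [uq le_qp sub_q]] := walk_upath _ _ _ walk_p last_p.
apply/visibleP; exists q; apply/andP; split.
  apply/shortest_pathP; split=> // r /and3P[walk_r /eqP last_r _].
  exact: leq_trans le_qp (min_p r walk_r last_r).
apply/allP=> x; rewrite !inE => x_in; apply/negP=> /andP[/norP[ne_u ne_v] Mx].
case/orP: x_in => [|/sub_q xp]; first by rewrite (negPf ne_u).
by rewrite (clear_p x xp Mx) eqxx in ne_v.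
Qed.

Lemma visible_sym M u v : visible M u v -> visible M v u.
Proof.
case/visibleP=> p /andP[/shortest_pathP[/and3P[walk_p /eqP last_p uniq_p] min_p] clear_p].
apply: (@visible_of_walk _ _ _ (rev (belast u p))).
- rewrite -last_p rev_path; under eq_path do rewrite adj_sym; exact: walk_p.
- by case: p {walk_p min_p uniq_p clear_p} last_p => //= x p last_p; rewrite rev_cons last_rcons.
- move=> x; rewrite mem_rev => x_in Mx.
  have := allP clear_p x; rewrite !inE Mx.
  have: x \in u :: p by rewrite lastI mem_rcons inE x_in orbT.
  move=> x_inp /(_ x_inp); rewrite andbT negbK => /orP[/eqP //|/eqP xv].
  by move: uniq_p; rewrite lastI rcons_uniq last_p -xv x_in.
- move=> q walk_q last_q; rewrite size_rev size_belast.
  have walk_rq: path (@adj G) u (rev (belast v q)).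
    by rewrite -last_q rev_path; under eq_path do rewrite adj_sym; exact: walk_q.
  have last_rq: last u (rev (belast v q)) = v.
    by case: q last_q {walk_q walk_rq} => //= x q last_q; rewrite rev_cons last_rcons.
  have [r [ur le_r _]] := walk_upath _ _ _ walk_rq last_rq.
  by apply: leq_trans (min_p r ur) _; move: le_r; rewrite size_rev size_belast.
Qed.
End Visibility.

(** * Walks on the torus *)

Definition wrap n (x : Z) : 'I_n.+1 := inord (Z.to_nat (x mod Z.of_nat n.+1)).

Lemma val_wrap n x : Z.of_nat (wrap n x) = (x mod Z.of_nat n.+1)%Z.
Proof.
have := Z.mod_pos_bound x (Z.of_nat n.+1) ltac:(lia) => bnd.
by rewrite /wrap inordK; lia.
Qed.

Lemma wrap_eq n x y : wrap n x = wrap n y <-> ((x - y) mod Z.of_nat n.+1 = 0)%Z.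
Proof.
rewrite -(Z.cong_iff_0 x y (Z.of_nat n.+1)) -!val_wrap.
by split=> [->//|E]; apply: val_inj => /=; lia.
Qed.

Lemma wrap_val n (i : 'I_n.+1) : wrap n (Z.of_nat i) = i.
Proof.
apply: val_inj => /=; apply: Nat2Z.inj; rewrite val_wrap Z.mod_small //.
by have := ltn_ord i; lia.
Qed.

Lemma modn_Z m d : 0 < d -> Z.of_nat (m %% d) = (Z.of_nat m mod Z.of_nat d)%Z.
Proof.
move=> d_gt0; have := divn_eq m d; have := ltn_pmod m d_gt0.
move: (m %/ d) (m %% d) => q r lt_rd Em.
by apply: (Z.mod_unique_pos _ _ (Z.of_nat q)); nia.
Qed.

Lemma ordS_wrap n x : ordS (wrap n x) = wrap n (x + 1).
Proof.
apply: val_inj => /=; apply: Nat2Z.inj.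
rewrite modn_Z // Nat2Z.inj_succ !val_wrap -Z.add_1_r.
by rewrite Zplus_mod_idemp_l.
Qed.

Lemma cycle_adj_wrap n x : 0 < n -> cycle_adj (wrap n x) (wrap n (x + 1)).
Proof.
move=> n_gt0; rewrite /cycle_adj /= ordS_wrap eqxx andbT.
apply/eqP => /wrap_eq; rewrite (_ : (x - (x + 1)) = -1)%Z; last by lia.
by rewrite -(Z_mod_plus_full _ 1) Z.mod_small; lia.
Qed.

Lemma cycle_adj_lift n x (j : 'I_n.+1) : cycle_adj (wrap n x) j ->
  exists e, Z.abs e = 1%Z /\ j = wrap n (x + e).
Proof.
rewrite /cycle_adj /= => /andP[_ /orP[/eqP ->|/eqP E]].
  by exists 1%Z; rewrite ordS_wrap.
exists (-1)%Z; split=> //; move: E; rewrite -(wrap_val n j) ordS_wrap.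
move/wrap_eq => /Z.mod_divide [|q Eq]; first by lia.
apply/wrap_eq; apply: Znumtheory.Zdivide_mod; exists (- q)%Z; lia.
Qed.

Lemma half_residue_minimal N a b :
  (0 < N -> (a - b) mod N = 0 -> 2 * Z.abs a <= N -> Z.abs a <= Z.abs b)%Z.
Proof.
move=> N_gt0 /Z.mod_divide [|q Eq] half; first by lia.
have [q0|q_ne0] := Z.eq_dec q 0; first by rewrite q0 in Eq; lia.
nia.
Qed.

Section Torus.
Variables (s t : nat).
Hypotheses (s_gt0 : 0 < s) (t_gt0 : 0 < t).
Local Notation S := (Z.of_nat s.+1).
Local Notation N := (Z.of_nat t.+1).
Let G := box_graph (cycle_graph s.+1) (cycle_graph t.+1).
Definition torus_point (x y : Z) : G := (wrap s x, wrap t y).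

Lemma torus_adj_lift X Y (v : G) : adj (torus_point X Y) v ->
  exists X1 Y1, v = torus_point X1 Y1 /\ (Z.abs (X1 - X) + Z.abs (Y1 - Y) = 1)%Z.
Proof.
case: v => a b /orP[] /= /andP[/cycle_adj_lift[e [abs_e ->]] /eqP <-].
  by exists (X + e)%Z, Y; split=> //; lia.
by exists X, (Y + e)%Z; split=> //; lia.
Qed.

Lemma torus_walk_lift p X Y : path (@adj G) (torus_point X Y) p ->
  exists X1 Y1, last (torus_point X Y) p = torus_point X1 Y1 /\
    (Z.abs (X1 - X) + Z.abs (Y1 - Y) <= Z.of_nat (size p))%Z.
Proof.
elim: p X Y => [|v p IHp] X Y; first by exists X, Y; split=> //=; lia.
move=> /andP[/torus_adj_lift[X2 [Y2 [-> short2]]] /IHp[X1 [Y1 [last_p short]]]].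
exists X1, Y1; split=> //.
by rewrite -[size (_ :: p)]/(size p).+1; lia.
Qed.

(** A walk of length n unrolls to a displacement of at most n, and among the
    displacements to the copies of the target one by at most half a turn in each
    direction is the shortest. *)
Lemma torus_walk_size p X Y X' Y' : path (@adj G) (torus_point X Y) p ->
  last (torus_point X Y) p = torus_point X' Y' ->
  (2 * Z.abs (X' - X) <= S -> 2 * Z.abs (Y' - Y) <= N ->
  Z.abs (X' - X) + Z.abs (Y' - Y) <= Z.of_nat (size p))%Z.
Proof.
move=> /torus_walk_lift[X1 [Y1 [-> short]]] [/wrap_eq Ex /wrap_eq Ey] half_x half_y.
have cx : ((X' - X - (X1 - X)) mod S = 0)%Z.
  by apply: Znumtheory.Zdivide_mod; move/Z.mod_divide: Ex => [|q Eq]; [lia|exists (- q)%Z; lia].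
have cy : ((Y' - Y - (Y1 - Y)) mod N = 0)%Z.
  by apply: Znumtheory.Zdivide_mod; move/Z.mod_divide: Ey => [|q Eq]; [lia|exists (- q)%Z; lia].
have := half_residue_minimal S _ _ ltac:(lia) cx half_x.
have := half_residue_minimal N _ _ ltac:(lia) cy half_y; lia.
Qed.

Lemma stair_walk (F : Z -> Z -> Prop) d X Y X' Y' : Z.abs d = 1%Z ->
  stair F d X Y X' Y' ->
  exists p, [/\ path (@adj G) (torus_point X Y) p,
    last (torus_point X Y) p = torus_point X' Y',
    Z.of_nat (size p) = (X' - X + d * (Y' - Y))%Z &
    forall v, v \in p -> exists x y, F x y /\ v = torus_point x y].
Proof.
move=> abs_d; elim=> [|x y _ [p [walk_p last_p size_p clear_p]] Fxy
                      |x y _ [p [walk_p last_p size_p clear_p]] Fxy].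
- by exists [::]; split=> //=; lia.
- exists (rcons p (torus_point (x + 1) y)); split.
  + by rewrite rcons_path walk_p last_p /= /box_adj /= cycle_adj_wrap // eqxx.
  + by rewrite last_rcons.
  + by rewrite size_rcons; lia.
  + by move=> v; rewrite mem_rcons inE => /orP[/eqP ->|/clear_p //]; exists (x + 1)%Z, y.
- exists (rcons p (torus_point x (y + d))); split.
  + rewrite rcons_path walk_p last_p /= /box_adj /= eqxx andbT; apply/orP; right.
    have [->|->] : d = 1%Z \/ d = (-1)%Z by lia.
      exact: cycle_adj_wrap.
    rewrite -[cycle_adj _ _]/(@adj (cycle_graph t.+1) _ _) adj_sym /=.
    by have := cycle_adj_wrap t (y + -1) t_gt0; rewrite (_ : y + -1 + 1 = y)%Z //; lia.
  + by rewrite last_rcons.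
  + by rewrite size_rcons; lia.
  + by move=> v; rewrite mem_rcons inE => /orP[/eqP ->|/clear_p //]; exists x, (y + d)%Z.
Qed.
End Torus.

(** * Lower bound: stretching a pattern *)

Section Stretch.
Variables (S N : Z).
Hypotheses (N_gt0 : (0 < N)%Z) (le_NS : (N <= S)%Z).
Local Open Scope Z_scope.

Definition stretch x := S * x / N.

Lemma stretch_spec x : N * stretch x <= S * x < N * stretch x + N.
Proof.
rewrite /stretch; have := Z.mul_div_le (S * x) N N_gt0.
by have := Z.mul_succ_div_gt (S * x) N N_gt0; lia.
Qed.

Lemma stretch_bound x : 0 <= x < N -> 0 <= stretch x < S.
Proof. by have := stretch_spec x; nia. Qed.

Lemma stretch_shift x q : stretch (x + q * N) = stretch x + q * S.
Proof.
rewrite /stretch (_ : S * (x + q * N) = S * x + q * S * N); last by ring.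
by rewrite Z.div_add //; lia.
Qed.

Lemma stretch_lt x x' : x < x' -> stretch x < stretch x'.
Proof. by have := stretch_spec x; have := stretch_spec x'; nia. Qed.

(** Half a turn of the stretched torus is at most (N + 1) / 2 columns of the
    original one; the summand 1 is needed for odd N and even S. *)
Lemma stretch_half x x' : 2 * (stretch x' - stretch x) <= S -> x' <= x + (N + 1) / 2.
Proof.
move=> half; have [//|far] := Z_le_gt_dec x' (x + (N + 1) / 2).
have two : N + 2 <= 2 * (x' - x) by Z.to_euclidean_division_equations; lia.
by have := stretch_spec x; have := stretch_spec x'; nia.
Qed.

(** A step right becomes a run through inserted columns, which hold no marks. *)
Lemma stair_stretch (M : Z -> Z -> Prop) d x y x' y' x1 y1 :
  stair (sole M x' y') d x y x1 y1 ->
  stair (fun a b => forall z, stretch z = a -> M z b -> z = x' /\ b = y') d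
    (stretch x) y (stretch x1) y1.
Proof.
elim=> [|z w _ IH clear_z|z w _ IH clear_z]; first by constructor.
- apply: stair_row IH _ _ => [|a a_in z1 Ez1]; first by have := stretch_lt z (z + 1); lia.
  have -> : z1 = z + 1; last exact: clear_z.
  have [lt_z|ge_z] := Z_lt_le_dec z z1; last first.
    have [Ez|ne_z] := Z.eq_dec z1 z; first by rewrite Ez in Ez1; lia.
    by have := stretch_lt z1 z; lia.
  have [//|ne_z] := Z.eq_dec z1 (z + 1).
  by have := stretch_lt (z + 1) z1; lia.
- apply: stair_vert IH _ => z1 Ez1.
  have -> : z1 = z; last exact: clear_z.
  have [//|ne_z] := Z.eq_dec z1 z.
  by have := stretch_lt z z1; have := stretch_lt z1 z; lia.
Qed.
End Stretch.

Section LowerBound.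
Variables (s t : nat).
Hypotheses (t_gt0 : 0 < t) (le_ts : t <= s).
Local Notation S := (Z.of_nat s.+1).
Local Notation N := (Z.of_nat t.+1).
Let G := box_graph (cycle_graph s.+1) (cycle_graph t.+1).
Variable f : Z -> nat -> Z.
Hypotheses (spread_f : spread N f) (joined_f : joined N (marked N f)).

Definition marked_set : {set G} :=
  [set torus_point s t (stretch S N (Z.of_nat p.1)) (f (Z.of_nat p.1) p.2) | p : 'I_t.+1 * 'I_3].

Let N_gt0 : (0 < N)%Z. Proof. lia. Qed.
Let le_NS : (N <= S)%Z. Proof. lia. Qed.

Lemma card_marked_set : #|marked_set| = 3 * t.+1.
Proof.
rewrite card_imset ?card_prod ?card_ord 1?mulnC // => -[x k] [x' k'] E.
have Ea : wrap s (stretch S N (Z.of_nat x)) = wrap s (stretch S N (Z.of_nat x')).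
  exact: (congr1 (fun v : 'I_s.+1 * 'I_t.+1 => v.1) E).
have /wrap_eq Eb : wrap t (f (Z.of_nat x) k) = wrap t (f (Z.of_nat x') k').
  exact: (congr1 (fun v : 'I_s.+1 * 'I_t.+1 => v.2) E).
have Ex : x = x'.
  apply: val_inj => /=; have := ltn_ord x; have := ltn_ord x' => lt_x' lt_x.
  have sx := stretch_bound S N N_gt0 le_NS (Z.of_nat x) ltac:(lia).
  have sx' := stretch_bound S N N_gt0 le_NS (Z.of_nat x') ltac:(lia).
  have Es : stretch S N (Z.of_nat x) = stretch S N (Z.of_nat x').
    by move/(congr1 (fun i : 'I_s.+1 => Z.of_nat i)): Ea; rewrite !val_wrap !Z.mod_small.
  have [//|] := Z.eq_dec (Z.of_nat x) (Z.of_nat x'); first by lia.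
  move=> ne; have := stretch_lt _ _ N_gt0 le_NS (Z.of_nat x) (Z.of_nat x').
  by have := stretch_lt _ _ N_gt0 le_NS (Z.of_nat x') (Z.of_nat x); lia.
rewrite -Ex in Eb *; congr pair; apply: val_inj; rewrite /=.
have := spread_f (Z.of_nat x); have := ltn_ord x => lt_x sp.
move/Z.mod_divide: Eb => [|q Eq]; first by lia.
move: Eq (ltn_ord k) (ltn_ord k'); move: (nat_of_ord k) (nat_of_ord k') => m m'.
have [q0|q_ne0] := Z.eq_dec q 0; last by case: m m' => [|[|[|m]]] [|[|[|m']]] // Eq; nia.
rewrite q0; case: m m' => [|[|[|m]]] [|[|[|m']]] // Eq; lia.
Qed.

Lemma mem_marked_set a b : torus_point s t a b \in marked_set ->
  exists2 x, stretch S N x = a & marked N f x b.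
Proof.
case/imsetP=> -[x k] _ E.
have /wrap_eq/Z.mod_divide Ea : wrap s a = wrap s (stretch S N (Z.of_nat x)).
  exact: (congr1 (fun v : 'I_s.+1 * 'I_t.+1 => v.1) E).
have /wrap_eq Eb : wrap t b = wrap t (f (Z.of_nat x) k).
  exact: (congr1 (fun v : 'I_s.+1 * 'I_t.+1 => v.2) E).
case: Ea => [|q Eq]; first by lia.
exists (Z.of_nat x + q * N)%Z; first by rewrite stretch_shift //; lia.
exists (nat_of_ord k); first exact: ltn_ord.
rewrite Z_mod_plus_full (Z.mod_small (Z.of_nat x)) //; have := ltn_ord x; lia.
Qed.

Lemma torus_point_val (v : G) : torus_point s t (Z.of_nat v.1) (Z.of_nat v.2) = v.
Proof. by case: v => a b; rewrite /torus_point !wrap_val. Qed.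

Lemma marked_visible a b a' b' :
  torus_point s t a b \in marked_set -> torus_point s t a' b' \in marked_set ->
  (a <= a')%Z -> (2 * (a' - a) <= S)%Z ->
  visible marked_set (torus_point s t a b) (torus_point s t a' b').
Proof.
move=> /mem_marked_set[x Ea mark_x] /mem_marked_set[x' Ea' mark_x'] le_a half.
have le_x : (x <= x')%Z.
  have [//|lt_x] := Z_le_gt_dec x x'; have := stretch_lt _ _ N_gt0 le_NS x' x; lia.
have le_x' : (x' <= x + (N + 1) / 2)%Z by apply: (stretch_half S) => //; rewrite ?Ea ?Ea'.
have [d [y1 [abs_d cong_y half_y dir_y st]]] := joined_f _ _ _ _ mark_x mark_x' (conj le_x le_x').
have := stair_stretch _ _ N_gt0 le_NS _ _ _ _ _ _ _ _ st; rewrite Ea Ea' => st'.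
have s_gt0 : 0 < s by lia.
have [p [walk_p last_p size_p clear_p]] := stair_walk s t s_gt0 t_gt0 _ _ _ _ _ _ abs_d st'.
have Ev : torus_point s t a' b' = torus_point s t a' y1.
  by congr pair; apply/esym/wrap_eq.
apply: (visible_of_walk _ _ _ _ _ walk_p).
- by rewrite last_p Ev.
- move=> v /clear_p[a1 [b1 [clear_v ->]]] /mem_marked_set[z Ez mark_z].
  have [Ezx ->] := clear_v z Ez mark_z; by rewrite Ev -Ez Ezx Ea'.
- move=> q walk_q; rewrite Ev => last_q.
  have := torus_walk_size _ _ _ _ _ _ _ _ _ walk_q last_q; lia.
Qed.

Lemma marked_set_mutual : mutual_visibility_set marked_set.
Proof.
apply/forall_inP=> u Mu; apply/forall_inP=> v Mv.
rewrite -(torus_point_val u) -(torus_point_val v) in Mu Mv *.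
(* One of the two marks is at most half a turn to the right of the other. *)
move: (Z.of_nat u.1) (Z.of_nat u.2) (Z.of_nat v.1) (Z.of_nat v.2) Mu Mv => a b a' b' Mu Mv.
have pt x y q : torus_point s t (x + q * S) y = torus_point s t x y.
  congr pair; apply/wrap_eq; rewrite (_ : x + q * S - x = q * S)%Z; last by lia.
  exact: Z_mod_mult.
have Er := Z.div_mod (a' - a) S ltac:(lia).
have bnd := Z.mod_pos_bound (a' - a) S ltac:(lia).
move: ((a' - a) / S)%Z ((a' - a) mod S)%Z Er bnd => q r Er bnd.
have [half|half] := Z_le_gt_dec (2 * r) S.
  rewrite -(pt a' b' (- q)%Z) in Mv *; apply: marked_visible => //; lia.
apply: visible_sym.
rewrite -(pt a b (q + 1)%Z) in Mu *; apply: marked_visible => //; lia.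
Qed.

Lemma le_mutual_visibility : 3 * t.+1 <= mutual_visibility_number G.
Proof. by rewrite -card_marked_set; apply: (bigmax_sup _ marked_set_mutual). Qed.
End LowerBound.

(** * Upper bound: rows hold at most three marks *)

(** Dropping the vertical steps of a walk leaves a walk in its first row. *)
Lemma box_row_walk (G H : sgraph) (u : box_graph G H) p : path (@adj (box_graph G H)) u p ->
  exists q, [/\ path (@adj G) u.1 q, last u.1 q = (last u p).1, size q <= size p &
    size q = size p -> all (fun v => v.2 == u.2) p].
Proof.
elim: p u => [|v p IHp] u; first by exists [::].
case/andP=> adj_v /IHp[q [walk_q last_q size_q stay_q]].
case/orP: adj_v => /andP[adj_v /eqP same].
  exists (v.1 :: q); split=> //=; first by rewrite adj_v.
  by case=> /stay_q all_p; rewrite -same eqxx same.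
exists q; rewrite same; split=> //=; first exact: leqW.
by move=> E; move: size_q; rewrite E ltnn.
Qed.

Lemma shortest_row (G H : sgraph) (u v : box_graph G H) p :
  u.2 = v.2 -> shortest_path u v p -> all (fun w => w.2 == u.2) p.
Proof.
move=> same_row /shortest_pathP[/and3P[walk_p /eqP last_p _] min_p].
have [q [walk_q last_q size_q stay_q]] := box_row_walk _ _ _ _ walk_p.
apply: stay_q; apply/eqP; rewrite eqn_leq size_q /=.
have walk_qr: path (@adj (box_graph G H)) u [seq (x, u.2) | x <- q].
  rewrite (surjective_pairing u) path_map.
  by apply: sub_path walk_q => x y adj_xy; rewrite /= /box_adj /= adj_xy eqxx.
have last_qr: last u [seq (x, u.2) | x <- q] = v.
  by rewrite (surjective_pairing u) last_map last_q last_p same_row -surjective_pairing.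
have [r [ur le_r _]] := walk_upath _ _ _ _ walk_qr last_qr.
by apply: leq_trans (min_p r ur) _; rewrite size_map in le_r.
Qed.

(** A walk on the cycle cannot leave the arc from d to b through 0 without
    visiting b or d. *)
Lemma cycle_walk_arc n (b d : 'I_n) x p : b < d -> path (@cycle_adj n) x p ->
  b \notin p -> d \notin p -> (x < b) || (d < x) -> (last x p < b) || (d < last x p).
Proof.
move=> lt_bd; elim: p x => //= y p IHp x /andP[adj_xy walk_p].
rewrite !inE !negb_or => /andP[ne_by b_p] /andP[ne_dy d_p] x_out.
apply: IHp => //.
have {}ne_by : (y : nat) <> b by move=> E; case/eqP: ne_by; apply: val_inj.
have {}ne_dy : (y : nat) <> d by move=> E; case/eqP: ne_dy; apply: val_inj.
move: ne_by ne_dy x_out.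
case/andP: adj_xy => _ /orP[]/eqP/(congr1 val) /=.
  move: (ltn_ord x) (ltn_ord d) => lt_x lt_d.
  have [->|ne] := eqVneq x.+1 (n : nat); first by rewrite modnn => ->; lia.
  by rewrite modn_small; lia.
move: (ltn_ord y) (ltn_ord d) => lt_y lt_d.
have [Ey|ne] := eqVneq y.+1 (n : nat); first by rewrite Ey modnn; lia.
by rewrite modn_small; lia.
Qed.

Lemma row_walk (G H : sgraph) (u : box_graph G H) p : path (@adj (box_graph G H)) u p ->
  all (fun w => w.2 == u.2) p -> path (@adj G) u.1 (map fst p).
Proof.
elim: p u => //= v p IHp u /andP[adj_uv walk_p] /andP[/eqP Ev row_p].
rewrite IHp // ?Ev // andbT; case/orP: adj_uv => /andP[] //.
by rewrite Ev adj_irr.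
Qed.

Lemma row_card_le3 n (H : sgraph) (M : {set box_graph (cycle_graph n) H}) (y : H) :
  mutual_visibility_set M -> #|[set x : 'I_n | (x, y) \in M]| <= 3.
Proof.
move=> mvM; rewrite leqNgt; apply/negP; set A := [set x | _]; rewrite cardE => big.
have srt: sorted (relpre val ltn) (enum A).
  rewrite /enum_mem -enumT; apply: sorted_filter; first by move=> ? ? ?; apply: ltn_trans.
  by rewrite -sorted_map val_enum_ord iota_ltn_sorted.
have inA x : x \in enum A -> (x, y) \in M by rewrite mem_enum inE.
case: (enum A) big srt inA => [|a [|b [|c [|d r]]]] //= _ /and4P[lt_ab lt_bc lt_cd _] inA.
have [Ma Mb Mc Md] : [/\ (a, y) \in M, (b, y) \in M, (c, y) \in M & (d, y) \in M].
  by split; apply: inA; rewrite !inE eqxx ?orbT.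
have /visibleP[p /andP[short_p clear_p]] := forall_inP (forall_inP mvM _ Ma) _ Mc.
have row_p := shortest_row (cycle_graph n) H (a, y) (c, y) p erefl short_p.
have /shortest_pathP[/and3P[walk_p /eqP last_p _] _] := short_p.
have off e : (e, y) \in M -> e != a -> e != c -> e \notin map fst p.
  move=> Me ne_a ne_c; apply/mapP=> -[[e' y'] vp /= Ee].
  have /eqP /= Ey := allP row_p _ vp.
  have := allP clear_p (e', y'); rewrite inE vp orbT => /(_ isT).
  by rewrite -Ee Ey !inE Me !xpair_eqE !eqxx !andbT (negPf ne_a) (negPf ne_c).
have walk_row: path (@cycle_adj n) a (map fst p).
  exact: row_walk walk_p row_p.
have Eac : last a (map fst p) = c by rewrite -[a]/((a, y).1) last_map last_p.
rewrite /relpre /= in lt_ab lt_bc lt_cd.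
have lt_bd := ltn_trans lt_bc lt_cd; have lt_ad := ltn_trans lt_ab lt_bd.
have := cycle_walk_arc n b d a (map fst p) lt_bd walk_row.
rewrite Eac lt_ab (ltnNge c b) (ltnNge d c) (ltnW lt_bc) (ltnW lt_cd) => enter_arc.
suff: false by []; apply: enter_arc => //; apply: off => //.
- by rewrite -val_eqE gtn_eqF.
- by rewrite -val_eqE ltn_eqF.
- by rewrite -val_eqE gtn_eqF.
- by rewrite -val_eqE gtn_eqF.
Qed.

Lemma mutual_visibility_le n (H : sgraph) (M : {set box_graph (cycle_graph n) H}) :
  mutual_visibility_set M -> #|M| <= 3 * #|H|.
Proof.
move=> mvM.
have -> : #|M| = \sum_(y : H) #|[set x : 'I_n | (x, y) \in M]|.
  rewrite -sum1_card; under [RHS]eq_bigr do rewrite -sum1_card.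
  rewrite (exchange_big_dep xpredT) //= pair_big_dep /=.
  by apply: eq_big => [[x y]|[x y]] //=; rewrite inE.
rewrite mulnC -sum_nat_const; apply: leq_sum => y _; exact: row_card_le3.
Qed.

Theorem theorem3p8 (t s : nat) (ht : 14 <= t \/ t = 12) (hs : t <= s) :
  mutual_visibility_number (box_graph (cycle_graph s) (cycle_graph t)) = 3 * t.
Proof.
apply/eqP; rewrite eqn_leq; apply/andP; split.
  apply/bigmax_leqP=> M mvM; apply: leq_trans (mutual_visibility_le _ _ M mvM) _.
  by rewrite card_ord.
have [f spread_f joined_f] := pattern_exists t ht.
case: t ht hs spread_f joined_f => [|t'] ht hs spread_f joined_f; first by lia.
case: s hs => [|s'] hs; first by lia.
by apply: (le_mutual_visibility s' t' _ _ f) => //; lia.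
Qed.
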